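(* For any $\beta<1$, the measure on $\mathbb{R}$ with density $|x|^{-\beta}dx$ is zero-stable. In particular, the Lebesgue measure on $\mathbb{R}$ is zero-stable.
   Context: For a linear functional $f(x_1,x_2)=a_1x_1+a_2x_2$ on $\mathbb{R}\times\mathbb{R}$ with $a_1a_2\ne0$, put $\|f\|_0=|a_1a_2|$. A ($\sigma$-finite) measure $F$ on $\mathbb{R}$ is called zero-stable if for each two such linear functionals $f_1$ and $f_2$ with $\|f_1\|_0=\|f_2\|_0$ there exists a transformation $L:\mathbb{R}\times\mathbb{R}\to\mathbb{R}\times\mathbb{R}$ preserving the measure $F\times F$ such that $f_2=f_1\circ L$. *)

(* Defs.v *)
From HB Require Import structures.
From mathcomp Require Import all_boot all_order all_algebra.
From mathcomp Require Import all_classical all_reals all_analysis.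
From mathcomp Require Import measurable_realfun.

Set Implicit Arguments.
Unset Strict Implicit.
Unset Printing Implicit Defensive.

Import Order.TTheory GRing.Theory Num.Theory.
Import numFieldNormedType.Exports.

Local Open Scope classical_set_scope.
Local Open Scope ring_scope.

Definition measure_preserving d (T : measurableType d) (R : realType)
    (mu : set T -> \bar R) (L : T -> T) : Prop :=
  measurable_fun [set: T] L /\
  forall A : set T, measurable A -> pushforward mu L A = mu A.

(* The functional a.1 x1 + a.2 x2 is represented by its coefficient pair a. *)
Definition functional (R : realType) (a x : R * R) : R :=
  a.1 * x.1 + a.2 * x.2.

Definition norm0 (R : realType) (a : R * R) : R := `|a.1 * a.2|.

Definition zero_stable (R : realType)
    (F : {sigma_finite_measure set (measurableTypeR R) -> \bar R}) : Prop :=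
  forall a b : R * R, a.1 * a.2 != 0 -> b.1 * b.2 != 0 -> norm0 a = norm0 b ->
  exists L : measurableTypeR R * measurableTypeR R ->
             measurableTypeR R * measurableTypeR R,
    measure_preserving (F \x F)%E L /\ functional b = functional a \o L.

Section power_measure.
Local Open Scope ereal_scope.
Context (R : realType) (beta : R).

(* At x = 0 the value of `|x| `^ (- beta) is the library's finite junk value;
   this is irrelevant since {0} is Lebesgue-null.  Hence the measure is defined,
   and sigma-finite, for every beta; it is locally finite iff beta < 1. *)
Definition power_measure (A : set (measurableTypeR R)) : \bar R :=
  \int[lebesgue_measure]_(x in A) (`|x| `^ (- beta))%:E.

Let density_ge0 (x : R) : 0 <= (`|x| `^ (- beta))%:E.
Proof. by rewrite lee_fin powR_ge0. Qed.

Let measurable_density :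
  measurable_fun setT (fun x : R => (`|x| `^ (- beta))%R).
Proof.
by apply: (measurableT_comp (measurable_powR _)) => //; exact: measurable_normr.
Qed.

Let power_measure0 : power_measure set0 = 0.
Proof. exact: integral_set0. Qed.

Let power_measure_ge0 A : 0 <= power_measure A.
Proof. by apply: integral_ge0 => x _; exact: density_ge0. Qed.

Let power_measure_sigma_additive : semi_sigma_additive power_measure.
Proof.
apply: semi_sigma_additive_nng_induced => //.
by apply/measurable_EFinP; exact: measurable_density.
Qed.

HB.instance Definition _ := isMeasure.Build _ _ _ power_measure
  power_measure0 power_measure_ge0 power_measure_sigma_additive.

Let power_measure_sigma_finite : sigma_finite setT power_measure.
Proof.
pose f (x : R) := (`|x| `^ (- beta))%R.
pose K (n : nat) : set R := `[(- n%:R)%R, n%:R] `&` f @^-1` `]-oo, n%:R].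
have mf (n : nat) : measurable (f @^-1` `]-oo, n%:R]).
  by rewrite -[X in measurable X]setTI; exact: measurable_density.
exists K.
  apply/esym; rewrite -subTset => x _; pose m := Num.max `|x|%R (f x).
  have [n mn] : exists n : nat, (m <= n%:R)%R.
    exists (Num.truncn m).+1; apply: ltW; exact: truncnS_gt.
  move: mn; rewrite /m ge_max => /andP[xn fxn].
  exists n => //; split => /=; rewrite in_itv/= ?fxn//.
  by rewrite -ler_norml.
move=> n; have mK : measurable (K n) by exact: measurableI.
split=> //; apply: (@le_lt_trans _ _ (\int[lebesgue_measure]_(x in K n) n%:R%:E)).
  apply: ge0_le_integral => //.
  - apply/measurable_EFinP; apply: measurable_funTS; exact: measurable_density.
  - by move=> x [_] /=; rewrite in_itv/= lee_fin.
rewrite integral_cst//= lte_mul_pinfty//.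
apply: (@le_lt_trans _ _ (lebesgue_measure (`[(- n%:R)%R, n%:R]%classic : set R))).
  by apply: le_measure; rewrite ?inE//; exact: subIsetl.
by rewrite lebesgue_measure_itv/=; case: ifP => _; rewrite ?ltry// -EFinD ltry.
Qed.

HB.instance Definition _ := @Measure_isSigmaFinite.Build _ _ _ power_measure
  power_measure_sigma_finite.

End power_measure.

(* Main.v *)
Require Import Defs.
From HB Require Import structures.
From mathcomp Require Import all_boot all_order all_algebra.
From mathcomp Require Import all_classical all_reals all_analysis.
From mathcomp Require Import measurable_realfun ring.

(** The transformation can be taken diagonal.  If [a] and [b] have nonzero
    entries and [|a.1 a.2| = |b.1 b.2|], put [c = b.1 / a.1] and
    [d = b.2 / a.2]: the map [L (x1, x2) = (c x1, d x2)] satisfies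
    [b = a \o L], and [|c d| = 1].

    The density [|x|^(-beta)] is homogeneous, so the dilation by [c] multiplies
    the measure by a power of [|c|] ([homogeneous_power_measure]; for the
    Lebesgue measure this is the usual scaling rule
    [homogeneous_lebesgue_measure]).  On a rectangle the two factors coming from
    [c] and [d] multiply to a power of [|c d| = 1], and a measure that agrees
    with a product of sigma-finite measures on rectangles is that product.  Hence
    [L] preserves [F \x F] as soon as [F] is homogeneous, whatever the degree
    ([zero_stable_homogeneous]). *)

Set Implicit Arguments.
Unset Strict Implicit.
Unset Printing Implicit Defensive.

Import Order.TTheory GRing.Theory Num.Theory.
Local Open Scope classical_set_scope.
Local Open Scope ring_scope.

Section homogeneity.
Context (R : realType).

(** The exponent [g] is attached to preimages under dilations, that is to images
    under [c^-1], so that its sign is opposite to the degree of [F] on sets: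
    [- 1] for the length. *)
Definition homogeneous (g : R) (F : set (measurableTypeR R) -> \bar R) : Prop :=
  forall c : R, c != 0 -> forall A : set (measurableTypeR R), measurable A ->
  F ( *%R c @^-1` A) = ((`|c| `^ g)%:E * F A)%E.

Lemma measurable_mulr (c : R) :
  measurable_fun [set: measurableTypeR R]
    ( *%R c : measurableTypeR R -> measurableTypeR R).
Proof. exact: mulrl_measurable. Qed.

(** The measure [|c| * lambda (c^-1 A)] has the value [b - a] on [`]a, b]], and
    these intervals determine the Lebesgue measure.  For [c < 0] the preimage of
    the interval is closed on the other side, which does not change its length. *)
Lemma homogeneous_lebesgue_measure : homogeneous (- 1) (@lebesgue_measure R).
Proof.
move=> c c0 A mA.
have c0' : 0 < `|c| by rewrite normr_gt0.
(* A pushforward is a measure only for a measurable map: the proof of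
   measurability is the argument of [m]. *)
pose m : {measure set (measurableTypeR R) -> \bar R} :=
  mscale (NngNum (normr_ge0 c)) (pushforward (@lebesgue_measure R)
    ( *%R c : measurableTypeR R -> measurableTypeR R)).
suff -> : lebesgue_measure A = m (measurable_mulr c) A.
  rewrite /m /= /mscale /pushforward /= muleA -EFinM powR_inv1//.
  by rewrite mulVf ?gt_eqF// mul1e.
apply: lebesgue_measure_unique => // _ [[a b]] _ <-.
rewrite /m /= /mscale /= /pushforward.
have [cn|cp|/eqP] := ltgtP c 0; last by rewrite (negbTE c0).
- rewrite (_ : _ @^-1` _ = `[b / c, a / c[%classic); last first.
    apply/seteqP; split => x /=; rewrite !in_itv/= ler_ndivrMr// ltr_ndivlMr//;
      by rewrite (mulrC c) andbC.
  rewrite !lebesgue_measure_itv/= !lte_fin ltr_nM2r ?invr_lt0//.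
  case: ifP => _; last by rewrite mule0.
  rewrite -!EFinB -EFinM ltr0_norm//; congr EFin; field; exact: c0.
- rewrite (_ : _ @^-1` _ = `]a / c, b / c]%classic); last first.
    apply/seteqP; split => x /=; rewrite !in_itv/= ler_pdivlMr// ltr_pdivrMr//;
      by rewrite (mulrC c).
  rewrite !lebesgue_measure_itv/= !lte_fin ltr_pM2r ?invr_gt0//.
  case: ifP => _; last by rewrite mule0.
  rewrite -!EFinB -EFinM gtr0_norm//; congr EFin; field; exact: c0.
Qed.

(** The substitution [y = c x] contributes [|c|^beta] from the density and
    [|c|^-1] from the Lebesgue measure. *)
Lemma homogeneous_power_measure (beta : R) :
  homogeneous (beta - 1) (power_measure beta).
Proof.
move=> c c0 A mA; rewrite /power_measure.
have c0' : `|c| != 0 by rewrite normr_eq0.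
pose h (y : R) : \bar R := (`|c| `^ beta * `|y| `^ (- beta))%:E.
have mdens D : measurable_fun D (fun y : R => (`|y| `^ (- beta))%:E).
  apply/measurable_EFinP; apply: measurable_funTS.
  by apply: (measurableT_comp (measurable_powR _)) => //; exact: measurable_normr.
have h0 y : (0 <= h y)%E by rewrite lee_fin mulr_ge0 ?powR_ge0.
have mh D : measurable_fun D h.
  by apply/measurable_EFinP/measurable_funM => //; apply/measurable_EFinP; apply: mdens.
transitivity (\int[lebesgue_measure]_(x in *%R c @^-1` A) (h \o *%R c) x)%E.
  apply: eq_integral => x _; rewrite /h /= normrM powRM// mulrA -powRD.
    by rewrite subrr powRr0 mul1r.
  by rewrite c0' implybT.
rewrite -(ge0_integral_pushforward (measurable_mulr c))//; last exact: mh.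
rewrite (eq_measure_integral
  (mscale (NngNum (powR_ge0 `|c| (- 1))) (@lebesgue_measure R))); last first.
  by move=> B mB _; exact: homogeneous_lebesgue_measure.
rewrite ge0_integral_mscale//=; last exact: mh.
under eq_integral do rewrite /h EFinM.
rewrite ge0_integralZl ?lee_fin ?powR_ge0//; last exact: mdens.
by rewrite muleA -EFinM [(_ * _)%R]mulrC -powRD// c0' implybT.
Qed.

End homogeneity.

(** The exponent [g] disappears because the two dilation factors only enter
    through [(|c| |d|)^g].  Sigma-finiteness is what reduces the equality of the
    two measures to rectangles. *)
Lemma measure_preserving_diag (R : realType) (g c d : R)
    (F : {sigma_finite_measure set (measurableTypeR R) -> \bar R}) :
  homogeneous g F -> c * d != 0 -> `|c * d| = 1 ->
  measure_preserving (F \x F)%E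
    (fun x : measurableTypeR R * measurableTypeR R => (c * x.1, d * x.2)).
Proof.
move=> homF; rewrite mulf_eq0 negb_or => /andP[c0 d0] cd1.
set L : _ -> measurableTypeR R * measurableTypeR R := fun x => _.
have mL : measurable_fun [set: measurableTypeR R * measurableTypeR R]
    L.
  by apply: measurable_fun_pair; apply: measurableT_comp => //; exact: measurable_mulr.
split=> // A mA.
pose m : {measure set (measurableTypeR R * measurableTypeR R) -> \bar R} :=
  pushforward (F \x F)%E L.
apply/esym; apply: (@product_measure_unique _ _ _ _ _ _ _ (m mL)) => // B C mB mC.
rewrite /m /= /pushforward.
have -> : L @^-1` (B `*` C) = ( *%R c @^-1` B) `*` ( *%R d @^-1` C) by [].
have mpre (e : R) (D : set (measurableTypeR R)) : measurable D ->
    measurable ( *%R e @^-1` D : set (measurableTypeR R)).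
  by move=> mD; rewrite -[X in measurable X]setTI; exact: measurable_mulr.
rewrite product_measure1E; [|exact: mpre|exact: mpre].
rewrite [X in (X * _)%E](homF _ c0)// [X in (_ * X)%E](homF _ d0)// muleACA -EFinM -powRM// -normrM cd1.
by rewrite powR1 mul1e.
Qed.

Lemma zero_stable_homogeneous (R : realType) (g : R)
    (F : {sigma_finite_measure set (measurableTypeR R) -> \bar R}) :
  homogeneous g F -> zero_stable F.
Proof.
move=> homF a b a0 b0 ab.
have := a0; rewrite mulf_eq0 negb_or => /andP[a10 a20].
have cdE : b.1 / a.1 * (b.2 / a.2) = b.1 * b.2 / (a.1 * a.2).
  by field; rewrite a10 a20.
exists (fun x => (b.1 / a.1 * x.1, b.2 / a.2 * x.2)); split.
  apply: (measure_preserving_diag homF); rewrite cdE.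
    by rewrite mulf_neq0// invr_neq0.
  move: ab; rewrite /norm0 normf_div => <-.
  by rewrite divff// normr_eq0.
apply/funext => x; rewrite /functional /=; field.
by rewrite a10 a20.
Qed.

Theorem proposition6 (R : realType) :
  (forall beta : R, beta < 1 -> zero_stable (power_measure beta)) /\
  zero_stable (@lebesgue_measure R).
Proof.
split.
  move=> beta _; apply: zero_stable_homogeneous.
  exact: homogeneous_power_measure.
apply: zero_stable_homogeneous.
exact: homogeneous_lebesgue_measure.
Qed.
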